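(* The class $\mathsf{FIFD}$ of all Kripke frames $\langle W,\prec,\{D_w\}_{w\in W}\rangle$ such that $W$ is finite, $\prec$ is transitive and irreflexive, and every domain $D_w$ is finite, does not have the fixed-point property.
   Context: Language $\mathcal{L}$: countably many individual variables, Boolean constants $\top,\bot$, connectives $\neg,\to$, the quantifier $\forall$, the modal operator $\Box$, and countably many predicate symbols of each arity (no function symbols, constants or equality). Formulas: $\top$, $\bot$, $P(u_1,\ldots,u_n)$, closed under $\neg$, $\to$, $\forall u$, $\Box$; $\lor,\land,\leftrightarrow,\exists,\Diamond$ are the usual abbreviations. $\mathcal{L}'$ is $\mathcal{L}$ together with one fixed propositional variable $p$ (an additional atomic formula). For an $\mathcal{L}'$-formula $A(p)$ and an $\mathcal{L}$-formula $B$, $A(B)$ denotes the result of replacing every occurrence of $p$ by $B$. $A(p)$ is modalized in $p$ if every occurrence of $p$ lies within the scope of a $\Box$. Kripke frame: $\mathcal{F}=\langle W,\prec,\{D_w\}_{w\in W}\rangle$ with $W\neq\emptyset$, $\prec$ a binary relation on $W$, each $D_w$ nonempty and $D_w\subseteq D_{w'}$ whenever $w\prec w'$. An interpretation assigns to each world $w$ and $n$-ary predicate $P$ an $n$-ary relation on $D_w$. Truth of sentences with parameters from $D_w$ at $w$ is defined as usual: $\forall u A(u)$ is true at $w$ iff $A(a)$ is true at $w$ for all $a\in D_w$, and $\Box A$ is true at $w$ iff $A$ is true at every $v$ with $w\prec v$. A formula is valid in a frame $\mathcal{F}$ ($\mathcal{F}\models A$) if its universal closure is true at every world under every interpretation.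 A class $\mathsf{C}$ of frames has the fixed-point property if for every $\mathcal{L}'$-formula $A(p)$ modalized in $p$ there exists an $\mathcal{L}$-formula $B$ containing only predicate symbols occurring in $A$ such that $\mathcal{F}\models B\leftrightarrow A(B)$ for every $\mathcal{F}\in\mathsf{C}$. *)

(* Defs.v *)
From mathcomp Require Import all_boot.
From mathcomp Require Import boolp classical_sets functions cardinality.

Set Implicit Arguments.
Unset Strict Implicit.
Unset Printing Implicit Defensive.

Local Open Scope classical_set_scope.

Notation var := nat (only parsing).

(* The pair [(n, k)] stands for the [k]-th predicate symbol of arity [n]. *)
Notation psym := (nat * nat)%type (only parsing).
Definition arity (P : psym) : nat := P.1.

(* [X] is the type of additional propositional variables: the language L is
   [form void], and L', with its single propositional variable p, is
   [form unit]. *)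
Inductive form (X : Type) : Type :=
  | Top
  | Bot
  | Atom (P : psym) (u : (arity P).-tuple var)
  | PVar (x : X)
  | Neg (A : form X)
  | Imp (A B : form X)
  | All (u : var) (A : form X)
  | Box (A : form X).

Arguments Top {X}.
Arguments Bot {X}.
Arguments Atom {X} P u.

Notation formL := (form void).
Notation formL' := (form unit).

Section Syntax.
Variable X : Type.
Implicit Types A B : form X.

Definition And A B := Neg (Imp A (Neg B)).
Definition Iff A B := And (Imp A B) (Imp B A).

Fixpoint fv A : seq var :=
  match A with
  | Top | Bot | PVar _ => [::]
  | Atom _ u => u
  | Neg A | Box A => fv A
  | Imp A B => fv A ++ fv B
  | All u A => [seq v <- fv A | v != u]
  end.

Definition univ_closure A : form X := foldr (@All X) A (undup (fv A)).

Fixpoint psyms A : seq psym :=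
  match A with
  | Top | Bot | PVar _ => [::]
  | Atom P _ => [:: P]
  | Neg A | Box A | All _ A => psyms A
  | Imp A B => psyms A ++ psyms B
  end.

Fixpoint modalized A : bool :=
  match A with
  | Top | Bot | Atom _ _ | Box _ => true
  | PVar _ => false
  | Neg A | All _ A => modalized A
  | Imp A B => modalized A && modalized B
  end.

End Syntax.

(* Literal replacement: free variables of [B] may be captured by quantifiers
   of [A]. *)
Fixpoint psubst (A : formL') (B : formL) : formL :=
  match A with
  | Top => Top
  | Bot => Bot
  | Atom P u => Atom P u
  | PVar _ => B
  | Neg A => Neg (psubst A B)
  | Imp A1 A2 => Imp (psubst A1 B) (psubst A2 B)
  | All u A => All u (psubst A B)
  | Box A => Box (psubst A B)
  end.

(* The domains are subsets of an ambient type [univ], so that the inclusions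
   between them are literal; [univ] may have elements lying in no domain. *)
Record frame : Type := Frame {
  world : Type;
  univ : Type;
  acc : world -> world -> Prop;
  dom : world -> set univ;
  world_inhabited : inhabited world;
  dom_nonempty : forall w, dom w !=set0;
  dom_mono : forall w v, acc w v -> dom w `<=` dom v
}.

Record interp (F : frame) : Type := Interp {
  rel_of :> world F -> forall P : psym, set ((arity P).-tuple (univ F));
  rel_of_dom : forall w P (t : (arity P).-tuple (univ F)),
    rel_of w t -> forall i, dom w (tnth t i)
}.

(* [g] supplies the parameters: only assignments with values in [dom w] are
   considered at [w]. *)
Fixpoint truth (F : frame) (I : interp F) (w : world F) (g : var -> univ F)
    (A : formL) : Prop :=
  match A with
  | Top => True
  | Bot => False
  | Atom P u => I w P (map_tuple g u)
  | PVar x => match x with end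
  | Neg A => ~ truth I w g A
  | Imp A B => truth I w g A -> truth I w g B
  | All u A => forall a, dom w a -> truth I w [eta g with u |-> a] A
  | Box A => forall v, acc w v -> truth I v g A
  end.

Definition valid (F : frame) (A : formL) : Prop :=
  forall (I : interp F) (w : world F) (g : var -> univ F),
    (forall u, dom w (g u)) -> truth I w g (univ_closure A).

Definition fixed_point_property (C : frame -> Prop) : Prop :=
  forall A : formL', modalized A ->
    exists B : formL, {subset psyms B <= psyms A} /\
      forall F : frame, C F -> valid F (Iff B (psubst A B)).

Definition FIFD (F : frame) : Prop :=
  [/\ finite_set [set: world F],
      forall w v z : world F, acc w v -> acc v z -> acc w z,
      forall w : world F, ~ acc w w &
      forall w : world F, finite_set (dom w)].

(* Main.v *)
(** The counterexample is A(p) = forall u. Box (p -> P(u)). Take the chain of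
    worlds N > ... > 1 > 0, where k sees every smaller world, let
    D_k = {k, ..., N + 2}, and let P fail at k exactly on the element k + 1.
    The only instance of P(u) with u in D_k that fails below k is the one for
    u = k at the world k - 1, so a fixed point B of A is true at k iff k = 0 or
    B is false at k - 1, i.e. iff k is even. On the other hand, seen from k
    an element e matters only through min (e - k, 2): it falsifies P at the
    next world, at the current one, or never (again). Hence a formula of modal
    depth r cannot tell apart the worlds k >= 2r, and B has the same value at
    2r and 2r + 1. *)

From mathcomp Require Import all_boot zify.
From mathcomp Require Import boolp classical_sets cardinality.
Require Import Defs.

Set Implicit Arguments.
Unset Strict Implicit.
Unset Printing Implicit Defensive.

Local Open Scope classical_set_scope.

Fixpoint modal_depth X (A : form X) : nat :=
  match A with
  | Top | Bot | Atom _ _ | PVar _ => 0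
  | Neg A | All _ A => modal_depth A
  | Imp A B => maxn (modal_depth A) (modal_depth B)
  | Box A => (modal_depth A).+1
  end.

Section Truth.
Variables (F : frame) (I : interp F).
Implicit Types (w : world F) (g : var -> univ F).

Lemma truth_Iff w g A B :
  truth I w g (Iff A B) -> (truth I w g A <-> truth I w g B).
Proof. by move=> /= /not_implyP[AB /contrapT BA]. Qed.

(** Each quantifier is instantiated at the value that [g] already gives its variable, so the updated
    assignment is [g] again. *)
Lemma truth_foldr_All w g A s : (forall u, dom w (g u)) ->
  truth I w g (foldr (@All void) A s) -> truth I w g A.
Proof.
move=> gw; elim: s => //= u s IHs /(_ _ (gw u)) gA; apply: IHs.
by congr (truth I w _ _): gA; apply/funext => x /=; case: eqP => [->|].
Qed.

Lemma valid_truth w g A : (forall u, dom w (g u)) ->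
  valid F A -> truth I w g A.
Proof. by move=> gw vA; apply: truth_foldr_All gw (vA _ _ _ gw). Qed.

End Truth.

Section Chain.
Variable N : nat.

Definition chain_dom (k : 'I_N.+1) : set nat := [set e | k <= e <= N.+2].

Lemma chain_dom_nonempty k : chain_dom k !=set0.
Proof. by exists N.+2; have := ltn_ord k; rewrite /chain_dom /=; lia. Qed.

Lemma chain_dom_mono (k m : 'I_N.+1) : m < k -> chain_dom k `<=` chain_dom m.
Proof. by move=> lt_mk e; rewrite /chain_dom /=; lia. Qed.

Definition chain : frame :=
  @Frame 'I_N.+1 nat (fun k m => m < k) chain_dom
    (inhabits ord0) chain_dom_nonempty chain_dom_mono.

Lemma chain_FIFD : FIFD chain.
Proof.
split=> [|k m l /= km ml|k /=|k].
- exact: finite_finset.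
- exact: ltn_trans ml km.
- by rewrite ltnn.
- by apply: (sub_finite_set _ (finite_II N.+3)) => e /=; rewrite /chain_dom /=; lia.
Qed.

(** All symbols follow one coordinatewise rule, so that the invariance below covers every
    formula. *)
Definition chain_rel (k : 'I_N.+1) (P : psym) : set ((arity P).-tuple nat) :=
  [set t | forall i, chain_dom k (tnth t i) /\ tnth t i <> k.+1].

Lemma chain_rel_dom (k : 'I_N.+1) (P : psym) (t : (arity P).-tuple nat) :
  chain_rel k t -> forall i, chain_dom k (tnth t i).
Proof. by move=> tk i; case: (tk i). Qed.

Definition chain_interp : interp chain :=
  @Interp chain chain_rel chain_rel_dom.

(** One implication suffices: the hypotheses are symmetric in the two worlds, and negation and
    implication use the induction hypothesis with the worlds swapped. *)
Lemma chain_truth_imp (A : formL) (k k' : 'I_N.+1) (g g' : var -> nat) :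
    minn k (modal_depth A).*2 = minn k' (modal_depth A).*2 ->
    (forall u, chain_dom k (g u)) -> (forall u, chain_dom k' (g' u)) ->
    (forall u, minn (g u - k) 2 = minn (g' u - k') 2) ->
  @truth chain chain_interp k g A -> @truth chain chain_interp k' g' A.
Proof.
elim: A k k' g g' => [||P u|[]|A IHA|A IHA B IHB|u A IHA|A IHA] k k' g g' /=
  kk' gk gk' gg' //.
- move=> Pu i; have [_] := Pu i; rewrite !tnth_map => ne.
  split=> //; have := gg' (tnth u i).
  by have := gk (tnth u i); have := gk' (tnth u i); rewrite /chain_dom /=; lia.
- by move=> nA gA; apply: nA; apply: IHA gA => // u; rewrite gg'.
- move=> AB gA; apply: (IHB k k' g g') => //; first by lia.
  by apply: AB; apply: (IHA k' k g' g) => //; lia.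
- move=> gA a' a'k'.
  (* The capped offset of [a'] is copied to [k]; the bound [N.+2] leaves room for it even at the top
     world. *)
  pose a := k + minn (a' - k') 2.
  have ak : chain_dom k a.
    by rewrite /a /chain_dom /=; have := ltn_ord k; lia.
  apply: IHA (gA a ak) => // x /=; case: eqP => // _.
  by move: a'k'; rewrite /a /chain_dom /=; lia.
- move=> gA m' lt_m'k'.
  have domE x : (k <= g x <= N.+2) /\ (k' <= g' x <= N.+2).
    by split; [exact: gk | exact: gk'].
  (* The world just below [k'] is matched by the one just below [k]. From any lower [m'] all offsets
     are at least 2, so [n] must be at most [k - 2]; this is why a box costs two levels. *)
  pose n := if m'.+1 == k' then k.-1 else minn m' (modal_depth A).*2.
  have lt_nk : n < k by rewrite /n; case: eqP; lia.
  have lt_nN : n < N.+1 by rewrite (ltn_trans lt_nk).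
  have nE : minn n (modal_depth A).*2 = minn m' (modal_depth A).*2.
    by rewrite /n; case: eqP; lia.
  have gn x : minn (g x - n) 2 = minn (g' x - m') 2.
    by have := gg' x; have := domE x; rewrite /n; case: eqP; lia.
  apply: (IHA (Ordinal lt_nN)) (gA (Ordinal lt_nN) lt_nk) => // x;
    by have := domE x; rewrite /chain_dom /=; lia.
Qed.

End Chain.

Definition counterexample : formL' :=
  All 0 (Box (Imp (PVar tt) (@Atom unit (1, 0) [tuple 0]))).

(** The statement is for all [g] because the quantifier of [counterexample] may capture variable 0
    in [B], which changes the assignment in the induction. *)
Lemma chain_fixed_point_even N (B : formL) (k : 'I_N.+1) (g : var -> nat) :
    valid (chain N) (Iff B (psubst counterexample B)) ->
    (forall u, chain_dom k (g u)) ->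
  @truth (chain N) (chain_interp N) k g B <-> ~~ odd k.
Proof.
move=> vB; move: {2}(k : nat) (leqnn k) => n.
elim: n k g => [|n IHn] k g kn gk;
  rewrite (truth_Iff (@valid_truth _ (chain_interp N) k g _ gk vB)) /=.
- by split=> [_|_ a _ m]; lia.
have gm a (m : 'I_N.+1) u : chain_dom k a -> m < k ->
    chain_dom m ([eta g with 0 |-> a] u).
  by move=> ak mk /=; apply: (chain_dom_mono mk); case: ifP.
split=> [gB|even_k a ak m mk].
- apply/negP => odd_k.
  have lt_k1 : k.-1 < N.+1 by have := ltn_ord k; lia.
  have kk : chain_dom k k by rewrite /chain_dom /=; have := ltn_ord k; lia.
  have lt_k1k : Ordinal lt_k1 < k by move=> /=; lia.
  have Bk1 : @truth (chain N) (chain_interp N) (Ordinal lt_k1)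
               [eta g with 0 |-> (k : nat)] B.
    by apply/IHn => [|u|] /=; [lia | exact: gm | lia].
  have [_] := gB _ kk _ lt_k1k Bk1 ord0.
  by rewrite tnth_map /=; lia.
- move=> /IHn Bm i; rewrite tnth_map [tnth _ i](tnth_nth 0).
  have -> : nat_of_ord i = 0 by case: i => -[].
  split; first exact: gm.
  have even_m : ~~ odd m by apply: Bm => [|u]; [lia | exact: gm].
  (* If [a = m.+1], then [m < k <= a] forces [k = m.+1], but [k] and [m] are both even. *)
  by move: ak; rewrite /chain_dom /=; lia.
Qed.

Theorem theorem3p6 : ~ fixed_point_property FIFD.
Proof.
move=> /(_ counterexample isT)[B [_ fixB]].
set r := (modal_depth B).*2.
have vB := fixB _ (chain_FIFD r.+1).
have lt_r : r < r.+2 by [].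
pose k := Ordinal lt_r; pose k' : 'I_r.+2 := ord_max.
(* The largest element: its offsets 3 from [k] and 2 from [k'] agree once capped at 2. *)
pose g (_ : var) := r.+3.
have gk u : chain_dom k (g u) by rewrite /chain_dom /g /=; lia.
have gk' u : chain_dom k' (g u) by rewrite /chain_dom /g /=; lia.
have Bk : @truth (chain r.+1) (chain_interp r.+1) k g B.
  by apply/(chain_fixed_point_even vB gk); rewrite odd_double.
suff : ~~ odd k' by rewrite /= odd_double.
apply/(chain_fixed_point_even vB gk'); apply: chain_truth_imp Bk => //=.
- by rewrite -/r; lia.
- by move=> u; rewrite /g; lia.
Qed.
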